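(* For every $n\ge 1$, $p_n^{1}(\mathbb{Q}_{\text{In-sh}}^{\textsf{pop}}) = p_n^{1}(\mathbb{Q}_{\text{Monge}}^{\textsf{pop}})$. In addition, for every $n\ge 3$, $$p_n^{1}(\mathbb{Q}_{\text{In-sh}}^{\textsf{pop}}) = p_n^{1}(\mathbb{Q}_{\text{Monge}}^{\textsf{pop}}) = a_{n-2},$$ where $a_1=2$, $a_2=4$ and $a_m=3a_{m-2}$ for $m\ge 3$.
   Context: Permutations are written in one-line notation; $S_n$ is the set of permutations of $[n]=\{1,\dots,n\}$, $id_n = 12\cdots n$, and $\varepsilon$ is the empty sequence. A shuffling method $\Sigma$ is a family of sets $\Pi_{\Sigma}^{n}\subseteq S_n$, $n\ge 2$. The In-shuffle method is given by the single-element sets $\Pi_{\text{In-sh}}^{2k}=\{(k+1)\,1\,(k+2)\,2\cdots(2k)\,k\}$ and $\Pi_{\text{In-sh}}^{2k+1}=\{(k+1)\,1\,(k+2)\,2\cdots(2k)\,k\,(2k+1)\}$. The Monge method is given by the single-element sets $\Pi_{\text{Monge}}^{n}=\{\cdots 6\,4\,2\,1\,3\,5\cdots\}$, i.e. the even numbers of $[n]$ in decreasing order followed by the odd numbers of $[n]$ in increasing order. The pop shuffle queue $\mathbb{Q}_{\Sigma}^{\textsf{pop}}$ processes configurations $(s_{inp},s_{dev},s_{out})$ of three sequences (input, content of the device, output), starting from $(\pi,\varepsilon,\varepsilon)$ and ending at $(\varepsilon,\varepsilon,\pi')$, using freely chosen operations: push (move the first element of the input to the end of $s_{dev}$); pop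 (append the entire non-empty content $s_{dev}$, in order, to the end of the output, leaving the device empty); shuffle (if $s_{dev}=s_1\cdots s_m$ with $m\ge2$, choose $\sigma\in\Pi_{\Sigma}^{m}$ and replace the content by $s_{\sigma(1)}\cdots s_{\sigma(m)}$). A shuffle may not be applied immediately after another shuffle. $p_n^{1}(\mathbb{Q}_{\Sigma}^{\textsf{pop}})$ is the number of $\pi\in S_n$ for which the final output $\pi'=id_n$ can be achieved using exactly one pop operation. *)

(* Defs.v *)
From mathcomp Require Import all_boot all_fingroup.
From mathcomp Require Import boolp.

Set Implicit Arguments.
Unset Strict Implicit.
Unset Printing Implicit Defensive.

(* 'S_n permutes {0, ..., n-1}; words use the letters 1, ..., n. *)
Definition one_line (n : nat) (s : 'S_n) : seq nat :=
  [seq (s i).+1 | i <- enum 'I_n].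

(* The values at n = 0 and n = 1 are never consulted: a shuffle needs at least
   two elements in the device. *)
Definition shuffling_method := forall n : nat, {set 'S_n}.

Definition in_shuffle_word (n : nat) : seq nat :=
  flatten [seq [:: n./2 + i; i] | i <- iota 1 n./2]
    ++ (if odd n then [:: n] else [::]).

Definition in_shuffle : shuffling_method :=
  fun n => [set s : 'S_n | one_line s == in_shuffle_word n].

Definition monge_word (n : nat) : seq nat :=
  rev [seq i <- iota 1 n | ~~ odd i] ++ [seq i <- iota 1 n | odd i].

Definition monge : shuffling_method :=
  fun n => [set s : 'S_n | one_line s == monge_word n].

(* The word s_{sigma(1)} ... s_{sigma(m)}. *)
Definition shuffle_word (s : seq nat) (sigma : 'S_(size s)) : seq nat :=
  [seq nth 0 s (sigma i) | i <- enum 'I_(size s)].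

Record config := Config { inp : seq nat; dev : seq nat; out : seq nat }.

Inductive operation := Push | Pop | Shuffle.

Definition is_pop (o : operation) : bool := if o is Pop then true else false.
Definition is_shuffle (o : operation) : bool :=
  if o is Shuffle then true else false.

Inductive step (Sigma : shuffling_method) :
    operation -> config -> config -> Prop :=
| step_push x s d t :
    step Sigma Push (Config (x :: s) d t) (Config s (rcons d x) t)
| step_pop s d t :
    d != [::] ->
    step Sigma Pop (Config s d t) (Config s [::] (t ++ d))
| step_shuffle s d t (sigma : 'S_(size d)) :
    1 < size d -> sigma \in Sigma (size d) ->
    step Sigma Shuffle (Config s d t) (Config s (shuffle_word sigma) t).

Inductive run (Sigma : shuffling_method) :
    seq operation -> config -> config -> Prop :=
| run_nil c : run Sigma [::] c c
| run_cons o ops c1 c2 c3 :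
    step Sigma o c1 c2 -> run Sigma ops c2 c3 -> run Sigma (o :: ops) c1 c3.

Definition no_consecutive_shuffles (ops : seq operation) : bool :=
  sorted (fun o1 o2 => ~~ (is_shuffle o1 && is_shuffle o2)) ops.

Definition sortable_with_pops (Sigma : shuffling_method) (k n : nat)
    (pi : 'S_n) : Prop :=
  exists ops : seq operation,
    [/\ no_consecutive_shuffles ops,
        count is_pop ops = k &
        run Sigma ops (Config (one_line pi) [::] [::])
                      (Config [::] [::] (one_line (1%g : 'S_n)))].

Definition pop_count (Sigma : shuffling_method) (k n : nat) : nat :=
  #|[set pi : 'S_n | `[< sortable_with_pops Sigma k pi >] ]|.

(* Indexed from 1; the value at 0 is a dummy. *)
Fixpoint a_seq (m : nat) : nat :=
  match m with
  | 0 => 0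
  | 1 => 2
  | 2 => 4
  | (m'.+1 as m1).+2 => 3 * a_seq m1
  end.

(* Main.v *)
Require Import Defs.
From mathcomp Require Import all_boot all_fingroup.
From mathcomp Require Import boolp.
From mathcomp Require Import zify.

Set Implicit Arguments.
Unset Strict Implicit.
Unset Printing Implicit Defensive.

(** With a single pop, that pop comes last, so a run pushes the whole input and
    may shuffle once after each push from the second on.  When the method
    offers one shuffle per size, a run is a choice of the sizes at which to
    shuffle, and its effect is a permutation of the positions of the input:
    the input pi is sorted exactly when pi is the inverse of that permutation
    ([sortable_one_popP]).  Hence the count is the number of distinct
    permutations that such choices produce ([pop_count_device_words]).

    Both methods share the features that determine this number
    ([paired_rule]).  The shuffle of size 2k+1 is the shuffle p of size 2k with
    the last letter left in place, so the sizes 2k and 2k+1 together apply 1, p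
    or p^2 to the words that have just received their letter number 2k.  For
    k = 1, p is a transposition and only two of the three products differ.  For
    k > 1, neither p nor p^2 fixes the last position, so the position of letter
    number 2k, which was last before the shuffle, tells 1 from p and 1 from
    p^2; cancelling p tells p from p^2.  Every content of size 2k-1 therefore
    extends in 2 distinct ways to size 2k ([distinct_even]) and in 3 distinct
    ways to size 2k+1 ([distinct_odd]), which is the recurrence of [a_seq]. *)

(** * Words acting on words *)

Definition letters {n : nat} (s : 'S_n) : seq nat :=
  [seq (s i : nat) | i <- enum 'I_n].

Definition rearrange (p w : seq nat) : seq nat := [seq nth 0 w j | j <- p].

Lemma size_letters n (s : 'S_n) : size (letters s) = n.
Proof. by rewrite size_map size_enum_ord. Qed.

Lemma nth_letters n (s : 'S_n) (i : 'I_n) : nth 0 (letters s) i = s i.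
Proof. by rewrite (nth_map i) ?size_enum_ord // nth_ord_enum. Qed.

Lemma one_line_letters n (s : 'S_n) : one_line s = map succn (letters s).
Proof. by rewrite -map_comp. Qed.

Lemma letters_inj n : injective (@letters n).
Proof.
move=> s t e; apply/permP => i; apply/val_inj.
by rewrite /= -!nth_letters e.
Qed.

(** A product of permutations acts with its left factor first, as a
    rearrangement does: it looks up the position before the letter. *)
Lemma rearrange_letters n (s t : 'S_n) :
  rearrange (letters s) (letters t) = letters (s * t)%g.
Proof.
rewrite /rearrange -map_comp; apply: eq_map => i /=.
by rewrite nth_letters permM.
Qed.

Lemma letters_onto n p : perm_eq p (iota 0 n) -> exists s : 'S_n, letters s = p.
Proof.
move=> pp; have sz : size p = n by rewrite (perm_size pp) size_iota.
have lt_p (i : 'I_n) : nth 0 p i < n.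
  have: nth 0 p i \in p by rewrite mem_nth ?sz.
  by rewrite (perm_mem pp) mem_iota.
have inj : injective (fun i => Ordinal (lt_p i)).
  move=> i j [/eqP]; rewrite nth_uniq ?sz // ?(perm_uniq pp) ?iota_uniq //.
  by move/eqP/val_inj.
exists (perm inj); apply: (@eq_from_nth _ 0); rewrite size_letters ?sz //.
by move=> i lt_i; rewrite (nth_letters _ (Ordinal lt_i)) permE.
Qed.

Lemma size_rearrange p w : size (rearrange p w) = size p.
Proof. exact: size_map. Qed.

Lemma rearrange_perm {n p w} :
  perm_eq p (iota 0 n) -> perm_eq w (iota 0 n) ->
  perm_eq (rearrange p w) (iota 0 n).
Proof.
move=> pp pw; rewrite (perm_trans (perm_map _ pp)) //.
have <- : size w = n by rewrite (perm_size pw) size_iota.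
by rewrite map_nth_iota0 // take_size (perm_trans pw) // (perm_size pw) size_iota.
Qed.

Lemma rearrange_inj {n p} :
  perm_eq p (iota 0 n) ->
  forall v w, size v = n -> size w = n -> rearrange p v = rearrange p w -> v = w.
Proof.
move=> pp v w sv sw e; apply: (@eq_from_nth _ 0); rewrite sv ?sw // => i lt_i.
have: i \in p by rewrite (perm_mem pp) mem_iota.
by move/eq_in_map: e => /[apply].
Qed.

Lemma rearrangeA {p q x} :
  all (ltn^~ (size q)) p ->
  rearrange p (rearrange q x) = rearrange (rearrange p q) x.
Proof.
move=> /allP lt_p; rewrite {3}/rearrange -map_comp; apply/eq_in_map => j /lt_p lt_j.
by rewrite /= (nth_map 0).
Qed.

Lemma shuffle_word_rearrange d (s : 'S_(size d)) :
  shuffle_word s = rearrange (letters s) d.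
Proof. by rewrite /rearrange -map_comp. Qed.

(** * Device contents before the pop *)

(** The letters of [p n] are 0, ..., n-1, so that they are positions in the
    device. *)
Definition follows (Sigma : shuffling_method) (p : nat -> seq nat) : Prop :=
  forall n (s : 'S_n), s \in Sigma n <-> letters s = p n.

Definition pushed (n : nat) (ws : seq (seq nat)) : seq (seq nat) :=
  [seq rcons w n | w <- ws].

Definition shuffled (p : nat -> seq nat) (n : nat) (ws : seq (seq nat)) :=
  if 1 < n then [seq rearrange (p n) w | w <- ws] else [::].

(** A content is recorded by the positions in the input of its letters. *)
Fixpoint device_words (p : nat -> seq nat) (n : nat) : seq (seq nat) :=
  if n is m.+1 then
    pushed m (device_words p m) ++ shuffled p n (pushed m (device_words p m))
  else [:: [::]].

(** The contents that may be shuffled: those whose last operation is not a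
    shuffle. *)
Definition fresh_words (p : nat -> seq nat) (n : nat) : seq (seq nat) :=
  if n is m.+1 then pushed m (device_words p m) else [:: [::]].

Lemma fresh_device p n w : w \in fresh_words p n -> w \in device_words p n.
Proof. by case: n => [|n] //= w_in; rewrite mem_cat w_in. Qed.

Lemma push_fresh {p n w} :
  w \in device_words p n -> rcons w n \in fresh_words p n.+1.
Proof. exact: map_f. Qed.

Lemma shuffle_device {p n w} :
  1 < n -> w \in fresh_words p n -> rearrange (p n) w \in device_words p n.
Proof.
case: n => [|n] //= lt1n w_in.
by rewrite mem_cat /shuffled lt1n map_f // orbT.
Qed.

Lemma device_wordsP p n w :
  w \in device_words p n ->
  w \in fresh_words p n \/
  exists2 v, v \in fresh_words p n & 1 < n /\ w = rearrange (p n) v.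
Proof.
case: n => [|n]; first by left.
rewrite /= mem_cat /shuffled => /orP[]; first by left.
by case: ifP => // lt1n /mapP[v v_in ->]; right; exists v.
Qed.

Lemma perm_rcons_iota m n w :
  perm_eq w (iota m n) -> perm_eq (rcons w (m + n)) (iota m n.+1).
Proof. by move=> pw; rewrite -(addn1 n) iotaD -cats1 perm_cat2r. Qed.

Lemma device_words_perm {p} :
  (forall n, perm_eq (p n) (iota 0 n)) ->
  forall n w, w \in device_words p n -> perm_eq w (iota 0 n).
Proof.
move=> pp; elim=> [|n IHn] w; first by rewrite inE => /eqP->.
have fresh v : v \in fresh_words p n.+1 -> perm_eq v (iota 0 n.+1).
  by case/mapP=> u /IHn pu ->; apply: (@perm_rcons_iota 0).
move/device_wordsP=> [/fresh //|[v /fresh pv [_ ->]]].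
exact: rearrange_perm.
Qed.

Lemma device_words_ltn {p} :
  (forall n, perm_eq (p n) (iota 0 n)) ->
  forall n w, w \in device_words p n -> all (ltn^~ n) w.
Proof.
move=> pp n w /(device_words_perm pp) pw.
by apply/allP=> i; rewrite (perm_mem pw) mem_iota.
Qed.

(** * Runs with a single pop *)

Lemma run_rcons Sigma ops o c1 c2 c3 :
  run Sigma ops c1 c2 -> step Sigma o c2 c3 -> run Sigma (rcons ops o) c1 c3.
Proof.
elim=> {c1 c2} [c st|o' ops' a b c st _ IH st'] /=.
  by apply: run_cons st _; apply: run_nil.
by apply: run_cons st _; apply: IH.
Qed.

Lemma no_consecutive_rcons ops o :
  ~~ is_shuffle o -> no_consecutive_shuffles ops ->
  no_consecutive_shuffles (rcons ops o).
Proof.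
rewrite /no_consecutive_shuffles; case: ops => //= o1 ops no.
by rewrite rcons_path negb_and no orbT andbT.
Qed.

Lemma no_consecutive_push_shuffle ops :
  no_consecutive_shuffles ops ->
  no_consecutive_shuffles (rcons (rcons ops Push) Shuffle).
Proof.
move=> /(@no_consecutive_rcons _ Push isT); rewrite /no_consecutive_shuffles.
by case: ops => //= o ops no; rewrite rcons_path no last_rcons.
Qed.

(** The output then never grows, and without a pop no letter can leave the
    input and the device. *)
Lemma run_without_pop Sigma ops c1 c2 :
  run Sigma ops c1 c2 -> count is_pop ops = 0 ->
  out c1 = out c2 /\
  size (inp c1) + size (dev c1) = size (inp c2) + size (dev c2).
Proof.
elim=> {ops c1 c2} [//|o ops c1 c2 c3 st _ IH] /=.
case: st IH => [x s d t|s d t _|s d t s0 _ _] //= IH /IH[-> <-]; split=> //.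
  by rewrite size_rcons addnS.
by rewrite size_map size_enum_ord.
Qed.

Lemma rearrange_push {q x i} :
  rcons (rearrange q x) (nth 0 x i) = rearrange (rcons q i) x.
Proof. by rewrite /rearrange map_rcons. Qed.

(** Generalized to the rest of a run for induction: i letters have been pushed,
    q records where the letters in the device come from, and b tells whether
    the operation just made was a shuffle, which forbids another one now. *)
Lemma run_device_word Sigma p x ops i q (b : bool) t :
  (forall n, perm_eq (p n) (iota 0 n)) -> follows Sigma p ->
  i <= size x ->
  q \in (if b then device_words p i else fresh_words p i) ->
  path (fun o1 o2 => ~~ (is_shuffle o1 && is_shuffle o2))
    (if b then Shuffle else Push) ops ->
  count is_pop ops = 1 ->
  run Sigma ops (Config (drop i x) (rearrange q x) [::]) (Config [::] [::] t) ->
  exists2 q', q' \in device_words p (size x) & t = rearrange q' x.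
Proof.
move=> pp fol; elim: ops i q b => [|o ops IH] i q b le_i q_in //=.
have q_dev : q \in device_words p i by case: b q_in => // /fresh_device.
have sz_q : size q = i by rewrite (perm_size (device_words_perm pp q_dev)) size_iota.
case/andP=> ok pth cnt r; inversion r as [|o' ops' c1 c2 c3 st r' E1 E2 E3]; subst.
inversion st as [y s d u E1 E2|s d u dn E1 E2|s d u sg lt1 sg_in E1 E2]; subst.
- have lt_i : size q < size x.
    by rewrite ltnNge; apply/negP=> /drop_oversize e; rewrite e in E2.
  move: E2; rewrite (drop_nth 0 lt_i) => -[Ey Es]; subst.
  rewrite rearrange_push in r'.
  apply: (IH (size q).+1 _ false) r' => //.
  exact: push_fresh.
- move: cnt => -[cnt]; case: (run_without_pop r' cnt) => /= <- /eqP.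
  rewrite addn0 size_drop => /eqP; rewrite addn0 => /eqP.
  rewrite subn_eq0 => ge_i.
  have e : size q = size x by apply/eqP; rewrite eqn_leq le_i.
  by exists q; rewrite -?e.
- case: b q_in ok pth => //= q_in _ pth.
  move: r'; rewrite shuffle_word_rearrange ((fol _ _).1 sg_in) size_rearrange rearrangeA.
    move=> r'; apply: (IH (size q) _ true) r' => //.
    by apply: shuffle_device => //; rewrite -(size_rearrange q x).
  by apply/allP=> j; rewrite (perm_mem (pp _)) mem_iota.
Qed.

Lemma step_shuffle_rearrange Sigma p s d t :
  (forall n, perm_eq (p n) (iota 0 n)) -> follows Sigma p -> 1 < size d ->
  step Sigma Shuffle (Config s d t) (Config s (rearrange (p (size d)) d) t).
Proof.
move=> pp fol lt1; have [sg e] := letters_onto (pp (size d)).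
by rewrite -e -shuffle_word_rearrange; apply: step_shuffle => //; apply/fol.
Qed.

Lemma device_word_run Sigma p x i q :
  (forall n, perm_eq (p n) (iota 0 n)) -> follows Sigma p ->
  i <= size x -> q \in device_words p i ->
  exists ops,
    [/\ no_consecutive_shuffles ops, count is_pop ops = 0 &
        run Sigma ops (Config x [::] [::])
                      (Config (drop i x) (rearrange q x) [::])].
Proof.
move=> pp fol; elim: i q => [|i IH] q le_i.
  by rewrite inE => /eqP->; exists [::]; rewrite drop0; split=> //; apply: run_nil.
have push v : v \in fresh_words p i.+1 -> exists ops,
    [/\ no_consecutive_shuffles ops, count is_pop ops = 0 &
        run Sigma (rcons ops Push) (Config x [::] [::])
                      (Config (drop i.+1 x) (rearrange v x) [::])].
  case/mapP=> u u_in ->; have [ops [nc cnt r]] := IH u (ltnW le_i) u_in.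
  exists ops; split=> //; apply: run_rcons r _.
  by rewrite (drop_nth 0 le_i) -rearrange_push; apply: step_push.
case/device_wordsP=> [/push|[v v_in [lt1 ->]]].
  case=> ops [nc cnt r]; exists (rcons ops Push).
  by split=> //; [apply: no_consecutive_rcons | rewrite -cats1 count_cat cnt].
have [ops [nc cnt r]] := push v v_in.
have sz : size v = i.+1.
  by rewrite (perm_size (device_words_perm pp (fresh_device v_in))) size_iota.
exists (rcons (rcons ops Push) Shuffle); split.
- exact: no_consecutive_push_shuffle.
- by rewrite -!cats1 !count_cat cnt.
apply: run_rcons r _; rewrite -rearrangeA; last first.
  by rewrite sz; apply/allP=> j; rewrite (perm_mem (pp _)) mem_iota.
rewrite -sz -(size_rearrange v x).
by apply: step_shuffle_rearrange => //; rewrite size_rearrange sz.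
Qed.

Lemma rearrange_succ q x :
  all (ltn^~ (size x)) q ->
  rearrange q (map succn x) = map succn (rearrange q x).
Proof.
move=> /allP lt_q; rewrite /rearrange -map_comp; apply/eq_in_map=> j /lt_q lt_j.
by rewrite /= (nth_map 0).
Qed.

(** The final content q spells the product of the permutations q and pi, which
    has to be the identity. *)
Lemma sortable_one_popP Sigma p n (pi : 'S_n) :
  (forall m, perm_eq (p m) (iota 0 m)) -> follows Sigma p -> 0 < n ->
  sortable_with_pops Sigma 1 pi <-> letters pi^-1%g \in device_words p n.
Proof.
move=> pp fol n_gt0; have sz : size (one_line pi) = n by rewrite size_map size_enum_ord.
split=> [[ops [nc cnt r]]|dev].
  (* A push before the run would forbid nothing, so it can stand for the start. *)
  have start : path (fun o1 o2 => ~~ (is_shuffle o1 && is_shuffle o2)) Push ops.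
    by case: ops nc {cnt r}.
  rewrite -[one_line pi in X in run _ _ X _]drop0 in r.
  have [q] := run_device_word (q := [::]) (b := false) pp fol (leq0n _) isT start cnt r.
  rewrite sz => q_in; rewrite !one_line_letters rearrange_succ; last first.
    by rewrite size_letters (device_words_ltn pp).
  have [s es] := letters_onto (device_words_perm pp q_in).
  move=> /(inj_map succn_inj); rewrite -es rearrange_letters => /letters_inj e.
  by rewrite -(mulg1_eq (esym e)) invgK es.
have [|ops [nc cnt r]] := @device_word_run Sigma p (one_line pi) n _ pp fol _ dev.
  by rewrite sz.
exists (rcons ops Pop); split.
- exact: no_consecutive_rcons.
- by rewrite -cats1 count_cat cnt.
apply: run_rcons r _; rewrite drop_oversize ?sz //.
have -> : rearrange (letters pi^-1%g) (one_line pi) = one_line (1%g : 'S_n).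
  rewrite !one_line_letters rearrange_succ ?rearrange_letters ?mulVg //.
  by rewrite size_letters (device_words_ltn pp).
rewrite -[X in Config _ _ X]cat0s; apply: step_pop.
by rewrite -size_eq0 size_map size_enum_ord -lt0n.
Qed.

Lemma pop_count_device_words Sigma p n :
  (forall m, perm_eq (p m) (iota 0 m)) -> follows Sigma p -> 0 < n ->
  pop_count Sigma 1 n = size (undup (device_words p n)).
Proof.
move=> pp fol n_gt0; rewrite /pop_count -(card_imset _ invg_inj) cardE.
rewrite -(size_map letters); apply/perm_size/uniq_perm.
- by rewrite map_inj_uniq ?enum_uniq //; apply: letters_inj.
- exact: undup_uniq.
move=> w; rewrite mem_undup; apply/mapP/idP => [[s]|w_in].
  rewrite mem_enum => /imsetP[pi]; rewrite inE => /asboolP srt -> ->.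
  exact/(sortable_one_popP _ pp fol n_gt0).
have [s es] := letters_onto (device_words_perm pp w_in).
exists s => //; rewrite mem_enum; apply/imsetP; exists s^-1%g; rewrite ?invgK //.
by rewrite inE; apply/asboolP/(sortable_one_popP _ pp fol n_gt0) => //; rewrite invgK es.
Qed.

(** * Counting the device words *)

(** The features common to the two methods.  The last one says that from size 4
    on, at even sizes, the last position lies on no cycle of length one or two
    of the shuffle. *)
Record paired_rule (p : nat -> seq nat) : Prop := PairedRule {
  rule_perm n : perm_eq (p n) (iota 0 n);
  rule_two : p 2 = [:: 1; 0];
  rule_odd k : p k.*2.+1 = rcons (p k.*2) k.*2;
  rule_last k : let q := p k.*2.+4 in
    [/\ nth 0 q k.*2.+3 != k.*2.+3 & nth 0 q (nth 0 q k.*2.+3) != k.*2.+3] }.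

Definition distinct (T : eqType) (s : seq T) : nat := size (undup s).

Lemma eq_distinct (T : eqType) (s t : seq T) : s =i t -> distinct s = distinct t.
Proof. by move=> e; apply/perm_size/perm_undup. Qed.

Lemma distinct_cat (T : eqType) (s t : seq T) :
  {in s, forall x, x \notin t} -> distinct (s ++ t) = distinct s + distinct t.
Proof.
move=> st; rewrite /distinct undup_cat size_cat (eq_in_filter (a2 := predT)).
  by rewrite filter_predT.
by move=> x; rewrite mem_undup => /st ->.
Qed.

Lemma distinct_map (S T : eqType) (f : S -> T) (s : seq S) :
  {in s &, injective f} -> distinct (map f s) = distinct s.
Proof.
move=> inj; rewrite /distinct -(size_map f); apply/perm_size/uniq_perm.
- exact: undup_uniq.
- rewrite map_inj_in_uniq ?undup_uniq // => x y; rewrite !mem_undup; exact: inj.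
by move=> y; rewrite mem_undup; apply: eq_mem_map => x; rewrite mem_undup.
Qed.

Lemma distinct_pushed n ws : distinct (pushed n ws) = distinct ws.
Proof. by apply: distinct_map => v w _ _ /rcons_inj[]. Qed.

Lemma perm_iota_nth_inj n w i j :
  perm_eq w (iota 0 n) -> i < n -> j < n -> nth 0 w i = nth 0 w j -> i = j.
Proof.
move=> pw lt_i lt_j /eqP; have sz : size w = n by rewrite (perm_size pw) size_iota.
by rewrite nth_uniq ?sz // ?(perm_uniq pw) ?iota_uniq // => /eqP.
Qed.

Lemma perm_iota_nth_ltn n w i : perm_eq w (iota 0 n) -> i < n -> nth 0 w i < n.
Proof.
move=> pw lt_i; have: nth 0 w i \in w by rewrite mem_nth // (perm_size pw) size_iota.
by rewrite (perm_mem pw) mem_iota.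
Qed.

Section Counting.

Variables (p : nat -> seq nat).
Hypothesis rule : paired_rule p.

Let pp : forall n, perm_eq (p n) (iota 0 n) := rule_perm rule.

Lemma fresh_words_perm n w : w \in fresh_words p n -> perm_eq w (iota 0 n).
Proof. by move/fresh_device; apply: device_words_perm. Qed.

Lemma nth_fresh_word n w : w \in fresh_words p n.+1 -> nth 0 w n = n.
Proof.
case/mapP=> v /(device_words_perm pp)/perm_size; rewrite size_iota => sz ->.
by rewrite nth_rcons sz ltnn eqxx.
Qed.

(** A fresh word has its greatest letter last, and a rearrangement that moves
    the last position brings another letter there. *)
Lemma rearrange_not_fresh n q u :
  perm_eq q (iota 0 n.+1) -> nth 0 q n != n ->
  u \in fresh_words p n.+1 -> rearrange q u \notin fresh_words p n.+1.
Proof.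
move=> pq q_n u_in; apply: contra q_n => /nth_fresh_word.
rewrite (nth_map 0); last by rewrite (perm_size pq) size_iota.
rewrite -[RHS](nth_fresh_word u_in) => /(perm_iota_nth_inj (fresh_words_perm u_in)) -> //.
exact: (perm_iota_nth_ltn pq).
Qed.

Lemma distinct_rearrange n ws :
  {subset ws <= device_words p n} ->
  distinct [seq rearrange (p n) w | w <- ws] = distinct ws.
Proof.
move=> sub; apply: distinct_map => v w /sub/(device_words_perm pp)/perm_size.
rewrite size_iota => sv /sub/(device_words_perm pp)/perm_size.
by rewrite size_iota => sw; apply: (rearrange_inj (pp n)).
Qed.

(** The position of the greatest letter tells whether the last shuffle was
    applied. *)
Lemma distinct_even k :
  distinct (device_words p k.*2.+4) = 2 * distinct (device_words p k.*2.+3).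
Proof.
have [q_n _] := rule_last rule k.
rewrite [device_words p k.*2.+4]/= /shuffled [1 < _]/= distinct_cat; last first.
  move=> u u_in; apply/mapP=> -[v v_in e]; move: u_in; apply/negP; rewrite e.
  exact: (rearrange_not_fresh (pp _) q_n v_in).
rewrite distinct_rearrange; last exact: (@fresh_device p k.*2.+4).
by rewrite distinct_pushed mul2n addnn.
Qed.

(** The shuffle of the odd size acts as the one of the previous size, before the
    last letter. *)
Lemma device_words_odd j (W := device_words p j.+1.*2) :
  device_words p j.+1.*2.+1 =
  pushed j.+1.*2 (W ++ [seq rearrange (p j.+1.*2) w | w <- W]).
Proof.
have -> : device_words p j.+1.*2.+1 =
  pushed j.+1.*2 W ++ [seq rearrange (p j.+1.*2.+1) w | w <- pushed j.+1.*2 W] by [].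
rewrite /pushed map_cat; congr cat; rewrite -!map_comp; apply/eq_in_map=> w w_in /=.
have pw := device_words_perm pp w_in.
have sz : size w = j.+1.*2 by rewrite (perm_size pw) size_iota.
rewrite (rule_odd rule j.+1) /rearrange map_rcons nth_rcons sz ltnn eqxx.
congr rcons; apply/eq_in_map => i; rewrite (perm_mem (pp _)) mem_iota add0n => /= lt_i.
by rewrite nth_rcons sz lt_i.
Qed.

(** With U the fresh words of the even size and q its shuffle, the contents to
    count are those of U, q U and q^2 U.  The first set is disjoint from the
    other two, whose union is the image under q of the device words U and q U
    of the even size. *)
Lemma distinct_odd k :
  distinct (device_words p k.*2.+1.+4) = 3 * distinct (device_words p k.*2.+3).
Proof.
have [q_n qq_n] := rule_last rule k; set q := p k.*2.+4 in q_n qq_n.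
have pq : perm_eq q (iota 0 k.*2.+4) by apply: pp.
rewrite (device_words_odd k.+1) distinct_pushed.
set W := device_words p _; set U := fresh_words p k.*2.+4.
have WE : W = U ++ [seq rearrange q u | u <- U] by [].
(* Shuffling at only one of the two sizes has the same effect for either. *)
rewrite (@eq_distinct _ _ (U ++ [seq rearrange q w | w <- W])); last first.
  move=> w; rewrite {1}WE !mem_cat -orbA; congr orb.
  by apply/orb_idl => /mapP[u u_in ->]; rewrite map_f // WE mem_cat u_in.
rewrite distinct_cat; last first.
  move=> u u_in; apply/mapP=> -[v v_in e]; move: u_in; apply/negP; rewrite e.
  move: v_in; rewrite WE mem_cat => /orP[v_in|/mapP[w w_in ->]].
    exact: (rearrange_not_fresh pq q_n v_in).
  rewrite rearrangeA; last first.
    by apply/allP=> i; rewrite (perm_mem pq) mem_iota (perm_size pq) size_iota.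
  apply: (rearrange_not_fresh (rearrange_perm pq pq) _ w_in).
  by rewrite (nth_map 0) // (perm_size pq) size_iota.
rewrite distinct_rearrange // /W (distinct_even k) distinct_pushed.
by rewrite -[X in X + _]mul1n -mulnDl.
Qed.

Lemma a_seq_even k : a_seq k.*2.+2 = 2 * a_seq k.*2.+1.
Proof.
elim: k => // k IH; rewrite doubleS.
by rewrite -[LHS]/(3 * a_seq k.*2.+2) -[a_seq _.+3]/(3 * a_seq k.*2.+1) IH mulnCA.
Qed.

(** The value does not mention p.  It starts from size 3, because p^2 = 1 at
    size 2 makes the step from size 1 to size 3 the only exception to the
    factor 3. *)
Lemma distinct_device_words n :
  0 < n -> distinct (device_words p n) = if n < 3 then n else a_seq (n - 2).
Proof.
have p3 : p 3 = [:: 1; 0; 2] by rewrite (rule_odd rule 1) (rule_two rule).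
have odd_case k : distinct (device_words p k.*2.+3) = a_seq k.*2.+1.
  elim: k => [|k IH]; first by rewrite /= /shuffled /= p3 (rule_two rule).
  by rewrite doubleS distinct_odd IH.
case: n => [|[|[|n]]] // _; first by rewrite /= /shuffled /= (rule_two rule).
rewrite !subSS subn0 -[n]odd_double_half; case: (odd n); rewrite ?add0n ?add1n.
  by rewrite distinct_even odd_case a_seq_even.
exact: odd_case.
Qed.

End Counting.

(** * The two methods *)

Lemma map_pred_perm n w : perm_eq w (iota 1 n) -> perm_eq (map predn w) (iota 0 n).
Proof.
have -> : iota 0 n = map predn (iota 1 n).
  by rewrite (iotaDl 1 0) -map_comp map_id_in.
exact: perm_map.
Qed.

Lemma follows_word (word : nat -> seq nat) :
  (forall n, perm_eq (word n) (iota 1 n)) ->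
  follows (fun n => [set s : 'S_n | one_line s == word n])
          (fun n => map predn (word n)).
Proof.
move=> pw n s; rewrite inE one_line_letters; split=> [/eqP <-|->].
  by rewrite -map_comp map_id_in.
apply/eqP; rewrite -map_comp -[RHS]map_id; apply/eq_in_map=> i.
by rewrite (perm_mem (pw n)) mem_iota => /andP[i_gt0 _]; rewrite /= prednK.
Qed.

(** The greatest letter n stands only at position c, so [nth 0 q j = n] forces
    j = c, and neither n nor [nth 0 q n] is c. *)
Lemma last_not_short_cycle n q c :
  perm_eq q (iota 0 n.+1) -> c < n -> nth 0 q c = n -> nth 0 q n != c ->
  nth 0 q n != n /\ nth 0 q (nth 0 q n) != n.
Proof.
move=> pq lt_c q_c q_n; split; [apply/negP|apply: contra q_n] => /eqP e.
  have := perm_iota_nth_inj pq (ltnW lt_c) (ltnSn n); rewrite q_c e => /(_ erefl) ec.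
  by rewrite ec ltnn in lt_c.
apply/eqP; apply: (perm_iota_nth_inj pq) (etrans e (esym q_c)); last exact: ltnW.
exact: (perm_iota_nth_ltn pq).
Qed.

Lemma flatten_pairs_perm (T I : eqType) (f g : I -> T) r :
  perm_eq (flatten [seq [:: f i; g i] | i <- r]) (map f r ++ map g r).
Proof.
elim: r => //= i r IH; rewrite perm_cons perm_sym -[g i :: map g r]cat1s.
by rewrite perm_catCA /= perm_cons perm_sym.
Qed.

Lemma in_shuffle_word_even k :
  in_shuffle_word k.*2 = flatten [seq [:: k + i; i] | i <- iota 1 k].
Proof. by rewrite /in_shuffle_word odd_double doubleK cats0. Qed.

Lemma in_shuffle_word_odd k :
  in_shuffle_word k.*2.+1 = rcons (in_shuffle_word k.*2) k.*2.+1.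
Proof.
by rewrite in_shuffle_word_even /in_shuffle_word /= odd_double uphalf_double cats1.
Qed.

Lemma monge_word_even k : monge_word k.*2.+2 = k.*2.+2 :: monge_word k.*2.+1.
Proof.
rewrite /monge_word -[k.*2.+2]addn1 iotaD !filter_cat /= add1n /= !odd_double /=.
by rewrite cats0 rev_cat addn1.
Qed.

Lemma monge_word_odd k : monge_word k.*2.+1 = rcons (monge_word k.*2) k.*2.+1.
Proof.
rewrite /monge_word -[k.*2.+1]addn1 iotaD !filter_cat /= add1n /= !odd_double /=.
by rewrite cats0 addn1 cats1 rcons_cat.
Qed.

Lemma in_shuffle_word_perm n : perm_eq (in_shuffle_word n) (iota 1 n).
Proof.
have even k : perm_eq (in_shuffle_word k.*2) (iota 1 k.*2).
  rewrite in_shuffle_word_even (perm_trans (flatten_pairs_perm _ _ _)) // map_id.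
  by rewrite -iotaDl perm_catC addnC -iotaD addnn.
rewrite -[n]odd_double_half; case: (odd n); rewrite ?add0n ?add1n //.
by rewrite in_shuffle_word_odd (@perm_rcons_iota 1).
Qed.

Lemma monge_word_perm n : perm_eq (monge_word n) (iota 1 n).
Proof.
rewrite perm_catC (perm_trans _ (permEl (perm_filterC odd _))) //.
by rewrite perm_cat2l perm_rev.
Qed.

Lemma in_shuffle_rule : paired_rule (fun n => map predn (in_shuffle_word n)).
Proof.
have pp n := map_pred_perm (in_shuffle_word_perm n).
split=> // [k|k]; first by rewrite in_shuffle_word_odd map_rcons.
have [w e] : exists w, map predn (in_shuffle_word k.*2.+4) = w ++ [:: k.*2.+3; k.+1].
  rewrite (in_shuffle_word_even k.+2) -(addn1 k.+1) iotaD map_cat flatten_cat map_cat.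
  by eexists; congr (_ ++ [:: _; _]); rewrite //= ?addn1 -addnn; lia.
have sw : size w = k.*2.+2.
  by have := perm_size (pp k.*2.+4); rewrite e size_cat size_iota addn2 => -[].
(* The greatest letter stands last but one. *)
apply: (last_not_short_cycle (c := k.*2.+2)) => //; rewrite e nth_cat sw.
  by rewrite ltnn subnn.
by rewrite ltnNge leqnSn subSnn /=; lia.
Qed.

Lemma monge_rule : paired_rule (fun n => map predn (monge_word n)).
Proof.
have pp n := map_pred_perm (monge_word_perm n).
split=> // [k|k]; first by rewrite monge_word_odd map_rcons.
have e : map predn (monge_word k.*2.+4) =
    k.*2.+3 :: rcons (map predn (monge_word k.*2.+2)) k.*2.+2.
  by rewrite (monge_word_even k.+1) (monge_word_odd k.+1) /= map_rcons.
(* The greatest letter stands first. *)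
apply: (last_not_short_cycle (c := 0)) => //; rewrite e //=.
by rewrite nth_rcons (perm_size (pp _)) size_iota ltnn eqxx.
Qed.

Theorem theorem5p12 :
  (forall n : nat, 1 <= n -> pop_count in_shuffle 1 n = pop_count monge 1 n) /\
  (forall n : nat, 3 <= n ->
     pop_count in_shuffle 1 n = pop_count monge 1 n /\
     pop_count monge 1 n = a_seq (n - 2)).
Proof.
have in_countE n : 0 < n -> pop_count in_shuffle 1 n = if n < 3 then n else a_seq (n - 2).
  move=> n_gt0.
  rewrite (pop_count_device_words (rule_perm in_shuffle_rule) _ n_gt0).
    exact: (distinct_device_words in_shuffle_rule).
  exact: (follows_word in_shuffle_word_perm).
have monge_countE n : 0 < n -> pop_count monge 1 n = if n < 3 then n else a_seq (n - 2).
  move=> n_gt0.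
  rewrite (pop_count_device_words (rule_perm monge_rule) _ n_gt0).
    exact: (distinct_device_words monge_rule).
  exact: (follows_word monge_word_perm).
split=> n n_ge; first by rewrite in_countE ?monge_countE.
have n_gt0 : 0 < n by apply: leq_trans n_ge.
by rewrite in_countE // monge_countE // ltnNge n_ge.
Qed.
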